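(* Let $T$ be an unbounded, locally finite metric space with root $o$, and let $\mathscr{C}(L^\infty)$ be the set of all composition operators $C_\varphi$ on $L^\infty(T)$, $\varphi$ a self-map of $T$, equipped with the operator norm topology, i.e. the topology induced by the metric $d_u(x,y)=\|x-y\|$ (operator norm). Then every point of $(\mathscr{C}(L^\infty),d_u)$ is isolated.
   Context: A metric space $(T,d)$ with a distinguished point $o$ (the root) is locally finite if for every $M>0$ the set $\{v\in T : d(o,v)<M\}$ is finite; it is unbounded if for every $M>0$ there is $v\in T$ with $d(o,v)\ge M$. $L^\infty=L^\infty(T)$ is the Banach space of bounded functions $f:T\to\mathbb{C}$ with norm $\|f\|_\infty=\sup_{v\in T}|f(v)|$. A self-map of $T$ is an arbitrary function $\varphi:T\to T$; the composition operator is $C_\varphi f=f\circ\varphi$, a bounded linear operator on $L^\infty(T)$. *)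

(* Defs.v *)
(* The norm of a normedModType over R[i] takes its values in R[i]: it is the
   image under %:C of the usual real-valued norm, here called rnorm. *)
From HB Require Import structures.
From mathcomp Require Import all_boot all_order all_algebra.
From mathcomp Require Import all_classical all_reals all_analysis.
From mathcomp Require Import complex.

Set Implicit Arguments.
Unset Strict Implicit.
Unset Printing Implicit Defensive.

Import Order.TTheory GRing.Theory Num.Theory.
Import numFieldNormedType.Exports.
Import ComplexField.

Local Open Scope classical_set_scope.
Local Open Scope ring_scope.
Local Open Scope complex_scope.

Section RealNorm.
Context {R : realType}.

Definition rnorm {V : normedZmodType R[i]} (x : V) : R := complex.Re `|x|.

Context {V : normedZmodType R[i]}.
Implicit Types x y : V.

Lemma rnormE x : `|x| = (rnorm x)%:C.
Proof. by rewrite /rnorm RRe_real. Qed.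

Lemma rnorm_ge0 x : 0 <= rnorm x.
Proof. by rewrite -ler0c -rnormE normr_ge0. Qed.

Lemma rnormD x y : rnorm (x + y) <= rnorm x + rnorm y.
Proof. by rewrite -lecR rmorphD /= -!rnormE ler_normD. Qed.

Lemma rnorm0 : rnorm (0 : V) = 0.
Proof. by apply: complexI; rewrite -rnormE normr0. Qed.

Lemma rnorm_eq0 x : rnorm x = 0 -> x = 0.
Proof. by move=> x0; apply/normr0_eq0; rewrite rnormE x0. Qed.

End RealNorm.

Lemma rnormZ (R : realType) (V : normedModType R[i]) (a : R[i]) (x : V) :
  rnorm (a *: x) = rnorm a * rnorm x.
Proof. by apply: complexI; rewrite rmorphM /= -!rnormE normrZ. Qed.

Section SupNorm.
Context {R : realType} {I : Type} {V : normedModType R[i]}.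
Implicit Types (A : set I) (f g : I -> V).

Definition supnorm A f : R := sup [set rnorm (f i) | i in A].

Definition bounded_over A f := exists M : R, forall i, A i -> rnorm (f i) <= M.

Lemma supnorm_ub A f i : bounded_over A f -> A i -> rnorm (f i) <= supnorm A f.
Proof.
move=> [M fM] Ai; apply: ub_le_sup; last by exists i.
by exists M => _ [j Aj <-]; exact: fM.
Qed.

Lemma supnorm_le A f M : 0 <= M -> (forall i, A i -> rnorm (f i) <= M) ->
  supnorm A f <= M.
Proof.
move=> M0 fM; have [->|/set0P A0] := eqVneq A set0.
  by rewrite /supnorm image_set0 sup0.
by apply: ge_sup; [exact: image_nonempty|move=> _ [i Ai <-]; exact: fM].
Qed.

Lemma supnorm_ge0 A f : bounded_over A f -> 0 <= supnorm A f.
Proof.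
move=> bf; have [->|/set0P[i Ai]] := eqVneq A set0.
  by rewrite /supnorm image_set0 sup0.
exact: le_trans (rnorm_ge0 (f i)) (supnorm_ub bf Ai).
Qed.

Lemma supnormD A f g : bounded_over A f -> bounded_over A g ->
  supnorm A (f \+ g) <= supnorm A f + supnorm A g.
Proof.
move=> bf bg; apply: supnorm_le => [|i Ai].
  by rewrite addr_ge0// supnorm_ge0.
by apply: le_trans (rnormD _ _) _; rewrite lerD// supnorm_ub.
Qed.

Lemma bounded_overZ A (a : R[i]) f :
  bounded_over A f -> bounded_over A (a \*: f).
Proof.
move=> [M fM]; exists (rnorm a * M) => i Ai /=.
by rewrite rnormZ ler_wpM2l ?rnorm_ge0 ?fM.
Qed.

Lemma supnormZ A (a : R[i]) f : bounded_over A f ->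
  supnorm A (a \*: f) = rnorm a * supnorm A f.
Proof.
move=> bf; apply/eqP; rewrite eq_le; apply/andP; split.
  apply: supnorm_le => [|i Ai]; first by rewrite mulr_ge0 ?rnorm_ge0 ?supnorm_ge0.
  by rewrite /= rnormZ ler_wpM2l ?rnorm_ge0 ?supnorm_ub.
have /predU1P[<-|a0] : (0 == rnorm a) || (0 < rnorm a).
  by rewrite -le_eqVlt rnorm_ge0.
  by rewrite mul0r supnorm_ge0//; exact: bounded_overZ.
rewrite mulrC -ler_pdivlMr//; apply: supnorm_le => [|i Ai].
  by rewrite divr_ge0 ?rnorm_ge0// supnorm_ge0//; exact: bounded_overZ.
rewrite ler_pdivlMr// mulrC -rnormZ.
exact: (supnorm_ub (bounded_overZ a bf) Ai).
Qed.

End SupNorm.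

Section Linf_space.
Context (T : Type) (R : realType).

Definition Linf_pred : {pred (T -> R[i])} :=
  fun f => `[< [bounded (f v : R[i]^o) | v in [set: T]] >].

Record Linf := MkLinf {
  Linf_fun :> T -> R[i];
  _ : Linf_fun \in Linf_pred }.

HB.instance Definition _ := [isSub for Linf_fun].
HB.instance Definition _ := [Choice of Linf by <:].

Lemma Linf_predP (f : T -> R[i]) :
  f \in Linf_pred <-> bounded_over [set: T] (f : T -> R[i]^o).
Proof.
split=> [/asboolP/pinfty_ex_gt0[M _ fM]|[M fM]].
  exists (complex.Re M) => v _; have := fM v I.
  by rewrite /= lecE => /andP[].
apply/asboolP; exists M%:C; split=> [|N /ltW MN v _ /=].
  by rewrite complex_real.
by apply: le_trans MN; rewrite rnormE lecR fM.
Qed.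

Lemma Linf_submod_closed : submod_closed Linf_pred.
Proof.
split=> [|a f g /Linf_predP[M fM] /Linf_predP[N gN]]; apply/Linf_predP.
  by exists 0 => v _; rewrite rnorm0.
exists (rnorm a * M + N) => v _.
apply: le_trans (rnormD _ _) _; apply: lerD; last exact: gN.
by rewrite (rnormZ (V := R[i]^o)) ler_wpM2l ?rnorm_ge0 ?fM.
Qed.

HB.instance Definition _ :=
  GRing.isSubmodClosed.Build R[i] (T -> R[i]) Linf_pred Linf_submod_closed.
HB.instance Definition _ := [SubChoice_isSubLmodule of Linf by <:].

Lemma Linf_bounded (f : Linf) : bounded_over [set: T] (f : T -> R[i]^o).
Proof. by apply/Linf_predP; exact: (valP f). Qed.

Definition Linf_norm (f : Linf) : R[i] :=
  (supnorm [set: T] (f : T -> R[i]^o))%:C.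

Lemma Linf_normD f g : Linf_norm (f + g) <= Linf_norm f + Linf_norm g.
Proof.
by rewrite /Linf_norm -rmorphD lecR; apply: supnormD; exact: Linf_bounded.
Qed.

Lemma Linf_normZ (a : R[i]) f : Linf_norm (a *: f) = `|a| * Linf_norm f.
Proof.
rewrite /Linf_norm rnormE -rmorphM; congr _%:C.
by apply: supnormZ; exact: Linf_bounded.
Qed.

Lemma Linf_norm_eq0 f : Linf_norm f = 0 -> f = 0.
Proof.
move=> /complexI f0; apply/val_inj/funext => v.
apply: (@rnorm_eq0 _ R[i]^o); apply/eqP; rewrite eq_le rnorm_ge0 andbT.
by rewrite -f0; apply: (supnorm_ub (Linf_bounded f)).
Qed.

HB.instance Definition _ :=
  Lmodule_isNormed.Build R[i] Linf Linf_normD Linf_normZ Linf_norm_eq0.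

Lemma Linf_normE (f : Linf) :
  `|f| = (sup [set complex.Re `|f v| | v in [set: T]])%:C.
Proof. by []. Qed.

End Linf_space.

Section bounded_operators.
Context (R : realType) (E F : normedModType R[i]).

Definition bounded_operator (u : E -> F) :=
  linear u /\ exists M : R, forall x, `|u x| <= M%:C * `|x|.

Definition Bop_pred : {pred (E -> F)} := fun u => `[< bounded_operator u >].

Record Bop := MkBop {
  Bop_fun :> E -> F;
  _ : Bop_fun \in Bop_pred }.

HB.instance Definition _ := [isSub for Bop_fun].
HB.instance Definition _ := [Choice of Bop by <:].

Lemma Bop_submod_closed : submod_closed Bop_pred.
Proof.
split=> [|a u w /asboolP[lu [M uM]] /asboolP[lw [N wN]]]; apply/asboolP; split.
- by move=> b x y; rewrite /= scaler0 addr0.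
- by exists 0 => x; rewrite normr0 mul0r.
- move=> b x y.
  rewrite -[LHS]/(a *: u (b *: x + y) + w (b *: x + y)).
  rewrite -[RHS]/(b *: (a *: u x + w x) + (a *: u y + w y)).
  by rewrite lu lw !scalerDr !scalerA [a * b]mulrC addrACA.
- exists (rnorm a * M + N) => x.
  rewrite -[X in `|X|]/(a *: u x + w x).
  apply: le_trans (ler_normD _ _) _.
  rewrite rmorphD rmorphM /= mulrDl -rnormE normrZ.
  by rewrite lerD// -mulrA ler_wpM2l.
Qed.

HB.instance Definition _ :=
  GRing.isSubmodClosed.Build R[i] (E -> F) Bop_pred Bop_submod_closed.
HB.instance Definition _ := [SubChoice_isSubLmodule of Bop by <:].

Lemma Bop_linear (u : Bop) : linear u.
Proof. by have /asboolP[] := valP u. Qed.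

HB.instance Definition _ (u : Bop) :=
  GRing.isLinear.Build R[i] E F _ (u : E -> F) (Bop_linear u).

Definition closed_unit_ball : set E := [set x | `|x| <= 1].

Lemma Bop_bounded (u : Bop) : bounded_over closed_unit_ball u.
Proof.
have /asboolP[_ [M uM]] := valP u; exists `|M| => x x1.
rewrite -lecR -rnormE; apply: le_trans (uM x) _.
apply: (@le_trans _ _ ((`|M|)%:C * `|x|)).
  by rewrite ler_wpM2r// lecR ler_norm.
by rewrite ler_piMr// ler0c.
Qed.

Definition opnorm (u : Bop) : R[i] := (supnorm closed_unit_ball u)%:C.

Lemma opnormD u w : opnorm (u + w) <= opnorm u + opnorm w.
Proof.
by rewrite /opnorm -rmorphD lecR; apply: supnormD; exact: Bop_bounded.
Qed.

Lemma opnormZ (a : R[i]) u : opnorm (a *: u) = `|a| * opnorm u.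
Proof.
rewrite /opnorm rnormE -rmorphM; congr _%:C.
by apply: supnormZ; exact: Bop_bounded.
Qed.

Lemma opnorm_eq0 u : opnorm u = 0 -> u = 0.
Proof.
move=> /complexI u0; apply/val_inj/funext => x /=.
have [->|x0] := eqVneq x 0; first by rewrite linear0.
have nx0 : `|x| != 0 by rewrite normr_eq0.
suff : u (`|x|^-1 *: x) = 0.
  by rewrite linearZ /= => /eqP; rewrite scaler_eq0 invr_eq0 (negbTE nx0) => /eqP.
apply: rnorm_eq0; apply/eqP; rewrite eq_le rnorm_ge0 andbT -u0.
apply: (supnorm_ub (Bop_bounded u)).
by rewrite /closed_unit_ball /= normrZ normfV normr_id mulVf.
Qed.

HB.instance Definition _ :=
  Lmodule_isNormed.Build R[i] Bop opnormD opnormZ opnorm_eq0.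

Lemma Bop_normE (u : Bop) :
  `|u| = (sup [set complex.Re `|u x| | x in [set x : E | `|x| <= 1]])%:C.
Proof. by []. Qed.

End bounded_operators.

Section composition_operators.
Context (R : realType) (T : Type).

Lemma comp_Linf_subproof (phi : T -> T) (f : Linf T R) :
  f \o phi \in @Linf_pred T R.
Proof.
apply/Linf_predP; have [M fM] := Linf_bounded f.
by exists M => v _; exact: fM.
Qed.

Definition comp_Linf (phi : T -> T) (f : Linf T R) : Linf T R :=
  MkLinf (comp_Linf_subproof phi f).

Lemma comp_op_subproof (phi : T -> T) :
  comp_Linf phi \in @Bop_pred R (Linf T R) (Linf T R).
Proof.
apply/asboolP; split=> [a f g|]; first exact: val_inj.
exists 1 => f; rewrite mul1r lecR.
apply: supnorm_le => [|v _]; first exact: (supnorm_ge0 (Linf_bounded f)).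
exact: (supnorm_ub (Linf_bounded f)).
Qed.

Definition comp_op (phi : T -> T) : Bop (Linf T R) (Linf T R) :=
  MkBop (comp_op_subproof phi).

Definition comp_ops : set (Bop (Linf T R) (Linf T R)) := range comp_op.

Lemma comp_opE phi (f : Linf T R) : comp_op phi f = f \o phi :> (T -> R[i]).
Proof. by []. Qed.

End composition_operators.
Arguments comp_op R {T} phi.
Arguments comp_ops R T : clear implicits.

Section rooted_metric_space.
Context (R : realType) (T : metricType R) (o : T).

Definition locally_finite :=
  forall M : R, 0 < M -> finite_set [set v : T | mdist o v < M].

Definition unbounded := forall M : R, 0 < M -> exists v : T, M <= mdist o v.

End rooted_metric_space.

(* Main.v *)
Require Import Defs.
From mathcomp Require Import all_boot all_order all_algebra.
From mathcomp Require Import all_classical all_reals all_analysis.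
From mathcomp Require Import complex.

(** Distinct composition operators are at distance at least 1 from each other:
    if [phi v] and [psi v] are different points, the indicator function [f] of
    the point [phi v] has norm at most 1, while [f \o phi] and [f \o psi] differ
    by 1 at [v].  So the open ball of radius 1 around a composition operator
    contains no other one.  The separation is [comp_op_separated]; it bounds the
    operator norm from below by the value at one test function ([Bop_norm_ge])
    and the supremum norm by the value at one point ([Linf_norm_ge]). *)

Import Order.TTheory GRing.Theory Num.Theory.
Import numFieldNormedType.Exports.
Import ComplexField.

Local Open Scope classical_set_scope.
Local Open Scope ring_scope.
Local Open Scope complex_scope.

Lemma Linf_norm_ge (R : realType) (T : Type) (f : Linf T R) (v : T) :
  `|f v| <= `|f|.
Proof.
rewrite (rnormE (f v : R[i]^o)) lecR.
exact: (supnorm_ub (Linf_bounded f)).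
Qed.

Lemma Bop_norm_ge (R : realType) (E F : normedModType R[i]) (u : Bop E F)
    (x : E) : `|x| <= 1 -> `|u x| <= `|u|.
Proof.
by move=> x1; rewrite rnormE lecR; exact: (supnorm_ub (Bop_bounded u)).
Qed.

Section point_indicator.
Context (R : realType) (T : Type) (x : T).

Lemma indic_norm_le1 (w : T) : `|\1_[set x] w : R[i]| <= 1.
Proof. by rewrite indicE; case: (_ \in _); rewrite ?normr1 ?normr0. Qed.

Lemma indic_Linf_pred : (\1_[set x] : T -> R[i]) \in @Linf_pred T R.
Proof.
by apply/Linf_predP; exists 1 => w _; rewrite -lecR -rnormE; exact: indic_norm_le1.
Qed.

Definition point_indic : Linf T R := MkLinf indic_Linf_pred.

Lemma point_indic_norm_le1 : `|point_indic| <= 1.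
Proof.
rewrite lecR; apply: supnorm_le => // w _.
by rewrite -lecR -rnormE; exact: indic_norm_le1.
Qed.

End point_indicator.

(** An indicator function takes values 1 apart at the two points that tell [phi]
    and [psi] apart, whence the constant 1. *)
Lemma comp_op_separated (R : realType) (T : Type) (phi psi : T -> T) :
  phi <> psi -> 1 <= `|comp_op R phi - comp_op R psi|.
Proof.
move=> phi_psi.
have [v phi_psi_v] : exists v, phi v <> psi v.
  by apply/existsNP => eqv; apply: phi_psi; apply/funext.
pose f := point_indic R T (phi v).
apply: (le_trans _ (Bop_norm_ge _ _ _ _ f (point_indic_norm_le1 _ _ _))).
apply: (le_trans _ (Linf_norm_ge _ _ _ v)).
suff -> : (comp_op R phi - comp_op R psi) f v = 1 by rewrite normr1.
rewrite -[LHS]/((\1_[set phi v] (phi v) : R[i]) - \1_[set phi v] (psi v)).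
by rewrite !indicE mem_set// memNset ?subr0// => /esym.
Qed.

Theorem corollary4p1 (R : realType) (T : metricType R) (o : T)
    (Tlf : locally_finite o) (Tub : unbounded o) :
  forall x : Bop (Linf T R) (Linf T R),
    comp_ops R T x -> isolated (comp_ops R T) x.
Proof.
move=> _ [phi _ <-]; split; first by apply/mem_set; exists phi.
exists (ball (comp_op R phi) 1); first exact: nbhsx_ballx.
apply/seteqP; split=> [y [+ [psi _ psiE]]|_ ->]; last first.
  by split; [exact: ballxx|exists phi].
rewrite -{y}psiE => near_phi.
have [phiE|phi_psi] := pselect (phi = psi); first by rewrite phiE.
move: near_phi; rewrite -ball_normE /ball_ /= => near_phi.
by have := comp_op_separated R _ _ _ phi_psi; move/le_lt_trans/(_ near_phi);
  rewrite ltxx.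
Qed.
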